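(* Under Assumptions 1 and 2 (stated in the context), if $\bar F$ is regularly varying with index $\alpha>2$ (i.e. $\bar F(x)=x^{-\alpha}L(x)$ with $\alpha>2$), then for the choice $$p_k=\frac{\bar F_I(b+n_{k-1}\mu)-\bar F_I(b+n_k\mu)}{\bar F_I(b)},\qquad k\ge1,$$ one has $$\mathbb{E}^Q[\nu_b]\le\frac{r+o(1)}{\mu(\alpha-2)}\,b,\qquad\text{as } b\nearrow\infty .$$
   Context: $X,X_1,X_2,\dots$ are i.i.d. real random variables with distribution function $F$, $\mathbb{E}X=0$, under a probability measure $\mathbb{P}$; $S_0=0$, $S_n=X_1+\dots+X_n$. Fix $\mu>0$ and an integer $r>1$. For $b>0$, $\tau_b:=\inf\{n\ge0: S_n-n\mu>b\}$. $n_0=0$, $n_k=r^k$ for $k\ge1$. Assumption 1: $\bar F(x):=\mathbb{P}\{X>x\}=x^{-\alpha}L(x)$ for some $\alpha>1$ and some slowly varying $L$ (i.e. $L(tx)/L(x)\to1$ as $x\to\infty$ for every $t>0$). Further, if $\mathrm{Var}[X]=\infty$, then $\limsup_{x\to\infty}\mathbb{P}\{X<-x\}/\mathbb{P}\{X>x\}<\infty$. Assumption 2: there is $t_0>0$ such that $L$ is continuously differentiable on $[t_0,\infty)$, and $L'(x)=o(L(x)/x)$ as $x\nearrow\infty$. $\bar F_I(x):=\int_x^\infty\bar F(u)\,du$. Simulation procedure for estimating $\mathbb{P}\{\tau_b<\infty\}$: draw an auxiliary random variable $K$ with $Q(K=k)=p_k$, $k\ge1$; given $K=k$, generate an estimator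 $Z_k(b)$ of $\mathbb{P}\{n_{k-1}<\tau_b\le n_k\}$ by importance sampling using only the increments $X_1,\dots,X_{n_k}$ (all of which are generated); return $Z_k(b)/p_k$. $Q$ is the probability measure induced by this procedure and $\mathbb{E}^Q$ its expectation. $\nu_b$ denotes the largest index of the increment random variables considered for simulation in a run; since $X_1,\dots,X_{n_K}$ are generated and none with larger index is, $\nu_b=n_K$. *)

(* Defs.v *)
From HB Require Import structures.
From mathcomp Require Import all_boot all_order all_algebra finmap.
From mathcomp Require Import all_classical all_reals all_analysis.

Set Implicit Arguments.
Unset Strict Implicit.
Unset Printing Implicit Defensive.

Import Order.TTheory GRing.Theory Num.Theory.
Import numFieldNormedType.Exports.

Local Open Scope classical_set_scope.
Local Open Scope ring_scope.

(* A sequence [X : nat -> {RV P >-> R}] stands for X, X_1, X_2, ...: the generic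
   copy X is [X 0] and the n-th increment X_n is [X n]. *)

Definition independent_sequence (R : realType) (d : measure_display)
    (T : measurableType d) (P : probability T R) (X : nat -> {RV P >-> R}) :=
  forall (J : {fset nat}) (A : nat -> set R), (forall i, measurable (A i)) ->
    P (\bigcap_(i in [set` J]) (X i @^-1` A i)) =
    (\prod_(i <- J) P (X i @^-1` A i))%E.

Definition identically_distributed (R : realType) (d : measure_display)
    (T : measurableType d) (P : probability T R) (X : nat -> {RV P >-> R}) :=
  forall (n : nat) (A : set R), measurable A ->
    distribution P (X n) A = distribution P (X 0) A.

Definition iid (R : realType) (d : measure_display)
    (T : measurableType d) (P : probability T R) (X : nat -> {RV P >-> R}) :=
  independent_sequence X /\ identically_distributed X.

Definition tail (R : realType) (d : measure_display)
    (T : measurableType d) (P : probability T R) (X : {RV P >-> R}) (x : R) : R :=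
  fine (ccdf X x).

Definition tailI (R : realType) (d : measure_display)
    (T : measurableType d) (P : probability T R) (X : {RV P >-> R}) (x : R) : R :=
  Rintegral (@lebesgue_measure R) `[x, +oo[ (tail X).

Definition slowly_varying (R : realType) (L : R -> R) :=
  forall t : R, 0 < t -> L (t * x) / L x @[x --> +oo] --> (1 : R).

Definition assumption1 (R : realType) (d : measure_display)
    (T : measurableType d) (P : probability T R) (X : {RV P >-> R})
    (alpha : R) (L : R -> R) :=
  [/\ 1 < alpha,
      slowly_varying L,
      (forall x : R, 0 < x -> tail X x = x `^ (- alpha) * L x) &
      'V_P[X] = +oo%E ->
        (limf_esup (fun x : R => (fine (P [set w | X w < - x]) / tail X x)%:E)
           (pinfty_nbhs R) < +oo)%E].

Canonical pinfty_nbhs_filter_on (R : numFieldType) :=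
  FilterType (pinfty_nbhs R) _.

Definition assumption2 (R : realType) (L : R -> R) :=
  exists2 t0 : R, 0 < t0 &
    [/\ (forall x, t0 <= x -> derivable L x 1),
        {within `[t0, +oo[, continuous (L^`())%classic} &
        (L^`())%classic =o_ (pinfty_nbhs R) (fun x => L x / x)].

(* [x i] is the (i+1)-th increment of the path. *)
Definition walk (R : realType) (x : nat -> R) (n : nat) : R :=
  \sum_(i < n) x i.

Definition tau (R : realType) (mu b : R) (x : nat -> R) : \bar R :=
  ereal_inf [set n%:R%:E | n in [set n : nat | b < walk x n - n%:R * mu]].

Definition epoch (r k : nat) : nat := if k is 0 then 0 else (r ^ k)%N.

(* The event n_{k-1} < tau_b <= n_k. *)
Definition crossing (R : realType) (mu b : R) (r k : nat) (x : nat -> R) : Prop :=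
  ((epoch r k.-1)%:R%:E < tau mu b x)%E /\ (tau mu b x <= (epoch r k)%:R%:E)%E.

(* The event above depends only on the first n_k increments, so that padding a
   finite path with zeros does not affect it. *)
Definition crossing_paths (R : realType) (mu b : R) (r k : nat) :
    set ((epoch r k).-tuple R) :=
  [set t | crossing mu b r k (nth 0 t)].
Arguments crossing_paths {R} mu b r k _.

Definition block_prob (R : realType) (d : measure_display)
    (T : measurableType d) (P : probability T R) (X : {RV P >-> R})
    (mu b : R) (r k : nat) : R :=
  (tailI X (b + (epoch r k.-1)%:R * mu) - tailI X (b + (epoch r k)%:R * mu))
  / tailI X b.

(* One run of the importance sampling procedure at level [b] with block
   probabilities [p] on the probability space ([sim_T], [sim_Q]).  Given K = k,
   the increments X_1, ..., X_{n_k} are drawn from the law [sim_law k] in place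
   of their law under P, and [sim_lr k] is the likelihood ratio of the latter
   with respect to the former, required only on the event to be estimated. *)
Record simulation (R : realType) (d : measure_display)
    (T : measurableType d) (P : probability T R) (X : nat -> {RV P >-> R})
    (mu : R) (r : nat) (b : R) (p : nat -> R) := Simulation {
  sim_d : measure_display;
  sim_T : measurableType sim_d;
  sim_Q : probability sim_T R;
  sim_law : forall k : nat, probability ((epoch r k).-tuple R) R;
  sim_lr : forall k : nat, (epoch r k).-tuple R -> R;
  sim_K : sim_T -> nat;
  sim_path : forall w : sim_T, (epoch r (sim_K w)).-tuple R;
  sim_K_measurable : measurable_fun setT sim_K;
  sim_K_law : forall k : nat, (0 < k)%N ->
    sim_Q [set w | sim_K w = k] = (p k)%:E;
  sim_path_measurable : forall (k : nat) (A : set ((epoch r k).-tuple R)),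
    measurable A ->
    measurable [set w | sim_K w = k /\
                        exists2 t, A t & tval t = sim_path w :> seq R];
  sim_path_law : forall (k : nat) (A : set ((epoch r k).-tuple R)),
    (0 < k)%N -> measurable A ->
    sim_Q [set w | sim_K w = k /\
                   exists2 t, A t & tval t = sim_path w :> seq R] =
    ((p k)%:E * sim_law k A)%E;
  sim_lr_ge0 : forall (k : nat) (t : (epoch r k).-tuple R), 0 <= @sim_lr k t;
  sim_lr_measurable : forall k : nat, measurable_fun setT (@sim_lr k);
  sim_lrP : forall (k : nat) (A : set ((epoch r k).-tuple R)),
    (0 < k)%N -> measurable A -> A `<=` crossing_paths mu b r k ->
    P [set w | A [tuple X i.+1 w | i < epoch r k]] =
    (\int[sim_law k]_(t in A) (sim_lr t)%:E)%E
}.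

Definition sim_Z (R : realType) (d : measure_display)
    (T : measurableType d) (P : probability T R) (X : nat -> {RV P >-> R})
    (mu : R) (r : nat) (b : R) (p : nat -> R) (s : simulation X mu r b p)
    (k : nat) (t : (epoch r k).-tuple R) : R :=
  sim_lr s t * \1_(crossing_paths mu b r k) t.

Definition sim_output (R : realType) (d : measure_display)
    (T : measurableType d) (P : probability T R) (X : nat -> {RV P >-> R})
    (mu : R) (r : nat) (b : R) (p : nat -> R) (s : simulation X mu r b p)
    (w : sim_T s) : R :=
  sim_Z s (sim_path w) / p (sim_K w).

(* The generated increments are X_1, ..., X_m with m the length of the path, so
   m is the largest index generated. *)
Definition sim_nu (R : realType) (d : measure_display)
    (T : measurableType d) (P : probability T R) (X : nat -> {RV P >-> R})
    (mu : R) (r : nat) (b : R) (p : nat -> R) (s : simulation X mu r b p)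
    (w : sim_T s) : nat :=
  size (sim_path w).

(* Main.v *)
Require Import Defs.
From HB Require Import structures.
From mathcomp Require Import all_boot all_order all_algebra finmap.
From mathcomp Require Import all_classical all_reals all_analysis.
From mathcomp Require Import measurable_realfun ring lra.
Import Order.TTheory GRing.Theory Num.Theory.
Import numFieldNormedType.Exports.
Local Open Scope classical_set_scope.
Local Open Scope ring_scope.

(** Write G for the integrated tail [tailI X] and n_k for [epoch r k].  A run with
    K = k generates n_k increments, so that the expected effort is
      sum_(k >= 1) n_k (G(b + n_(k-1) mu) - G(b + n_k mu)) / G(b).
    Since n_(k+1) - n_k <= r (n_k - n_(k-1)), summation by parts
    ([epoch_summation_by_parts]) bounds this by
      r + r sum_(k >= 1) (n_k - n_(k-1)) G(b + n_k mu) / G(b),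
    which is r plus r / (mu G(b)) times a lower Riemann sum of the integral of G
    over [b, +oo[.  It remains to see that this integral is at most about
    b G(b) / (alpha - 2), a case of Karamata's theorem.

    The condition L' = o(L / x) makes this elementary.  For every delta > 0, the
    function x^(- delta) L(x) has a nonpositive derivative for large x
    ([nonincreasing_powRN_mul]), so that x^(alpha - delta) times the tail of X is
    eventually nonincreasing.  Substituting u = c v in the integral defining
    G(c b) gives G(c b) <= c^(1 - (alpha - delta)) G(b) for all c >= 1 and all
    large b ([tailI_dilation_le]).  With s = alpha - 2 - delta the ratios
    G(b + n_k mu) / G(b) are thus at most (1 + n_k mu / b)^(- (1 + s)), whose
    Riemann sum telescopes ([powRN_telescope]).  The outcome is a bound
    r + r b / (mu s) for all large b ([expectation_sim_nu_dilation_le]); as delta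
    is arbitrary, the theorem follows. *)

(** * Slowly varying factors and dilation of integrals *)

(** A nonnegative L with L' = o(L / x) is dominated by every positive power: the
    derivative x^(- delta) (L' - delta L / x) is eventually nonpositive. *)
Lemma nonincreasing_powRN_mul {R : realType} (L : R -> R) (t0 delta : R) :
  0 < delta ->
  (forall x, t0 <= x -> derivable L x 1) ->
  (\forall x \near +oo, 0 <= L x) ->
  (L^`())%classic =o_ (pinfty_nbhs R) (fun x => L x / x) ->
  \forall x0 \near +oo, forall x y, x0 <= x -> x <= y ->
    y `^ (- delta) * L y <= x `^ (- delta) * L x.
Proof.
move=> delta_gt0 dL L_ge0 /eqoP /(_ delta delta_gt0) dL_small.
have [M [_ ML]] : \forall x \near +oo,
    [/\ 0 <= L x, `|(L^`())%classic x| <= delta * `|L x / x|, t0 <= x & 0 < x].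
  near=> x; split; near: x;
    [by []|exact: dL_small|exact: nbhs_pinfty_ge (num_real _)
    |exact: nbhs_pinfty_gt (num_real _)].
near=> x0 => x y x0x xy.
have Mx0 : M < x0 by near: x0; exact: nbhs_pinfty_gt (num_real _).
have df (z : R) : x0 <= z -> is_derive z 1 (fun u => u `^ (- delta) * L u)
    (z `^ (- delta) *: (L^`())%classic z
       + L z *: (- delta * z `^ (- delta - 1))).
  move=> x0z; have [_ _ t0z z_gt0] := ML _ (lt_le_trans Mx0 x0z).
  rewrite derive1E.
  have dLz : is_derive z 1 L ('D_1 L z) by apply: derivableP; exact: dL.
  have dpz := is_derive1_powR (- delta) z_gt0.
  exact: (is_deriveM dpz dLz).
apply: (@ler0_derive1_nincry _ (fun u => u `^ (- delta) * L u) x0) => //.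
- by move=> z; rewrite in_itv/= andbT => /ltW /df [].
- move=> z; rewrite in_itv/= andbT => /ltW x0z.
  have [L0 dLz _ z_gt0] := ML _ (lt_le_trans Mx0 x0z).
  rewrite derive1E; have [_ ->] := df _ x0z.
  rewrite powRB ?(gt_eqF z_gt0) ?implybT// powRr1 ?(ltW z_gt0)//.
  have -> : z `^ (- delta) *: (L^`())%classic z
      + L z *: (- delta * (z `^ (- delta) / z))
    = z `^ (- delta) * ((L^`())%classic z - delta * (L z / z)).
    rewrite /GRing.scale/=; ring.
  apply: mulr_ge0_le0; first exact: powR_ge0.
  rewrite subr_le0 (le_trans (ler_norm _))// (le_trans dLz)// ger0_norm//.
  by rewrite divr_ge0// ltW.
- apply: derivable_within_continuous => z; rewrite in_itv/= andbT => /df.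
  by case.
Unshelve. all: end_near. Qed.

(** If x^gamma f(x) is nonincreasing on [a, +oo[, then f(c x) <= c^(- gamma) f(x)
    there, and the substitution of c x for x contributes one more factor c. *)
Lemma ge0_integral_dilation_le {R : realType} (f : R -> R) (gamma a c : R) :
  0 < a -> 1 <= c ->
  measurable_fun setT f ->
  {within `[a, +oo[, continuous f} ->
  (forall x, 0 <= f x) ->
  (forall x y, a <= x -> x <= y ->
     y `^ gamma * f y <= x `^ gamma * f x) ->
  (\int[@lebesgue_measure R]_(x in `[(c * a)%R, +oo[) (f x)%:E <=
   (c `^ (1 - gamma))%:E *
     \int[@lebesgue_measure R]_(x in `[a, +oo[) (f x)%:E)%E.
Proof.
move=> a_gt0 c_ge1 mf cf f_ge0 f_decr.
have c_gt0 : 0 < c by exact: lt_le_trans c_ge1.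
have aca : a <= c * a by rewrite ler_peMl// ltW.
have dc (x : R) : is_derive x 1 ( *%R c) c.
  by apply: (is_derive_eq (is_deriveZ _ _ )); rewrite /GRing.scale/= mulr1.
have dcE : (( *%R c)^`())%classic = cst c.
  by apply/funext => x; rewrite derive1E; have [_ ->] := dc x.
have cc : continuous ( *%R c) by move=> x; exact: mulrl_continuous.
rewrite (@increasing_ge0_integration_by_substitutiony _ ( *%R c) f a)//.
- rewrite -ge0_integralZl//; last 3 first.
  + exact/measurable_EFinP/measurable_funTS.
  + by move=> x _; rewrite lee_fin.
  + by rewrite lee_fin powR_ge0.
  apply: ge0_le_integral => //.
  + by move=> x _; rewrite lee_fin dcE mulr_ge0 ?f_ge0 ?ltW.
  + rewrite dcE; apply/measurable_EFinP/measurable_funTS/measurable_funM => //.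
    apply: measurableT_comp => //; exact: measurable_funM.
  + by apply/measurable_EFinP/measurable_funTS; exact: measurable_funM.
  move=> x; rewrite /= in_itv/= andbT => ax.
  rewrite -EFinM lee_fin dcE.
  have x_gt0 := lt_le_trans a_gt0 ax.
  have /(f_decr _ _ ax) : x <= c * x by rewrite ler_peMl// ltW.
  rewrite powRM ?(ltW c_gt0) ?(ltW x_gt0)// [c `^ _ * _]mulrC.
  rewrite -mulrA ler_pM2l ?powR_gt0// => fcx.
  have cE : c = c `^ (1 - gamma) * c `^ gamma.
    by rewrite -powRD ?subrK ?powRr1 ?(ltW c_gt0)// (gt_eqF c_gt0) implybT.
  by rewrite fctE/= {2}cE mulrC -mulrA ler_wpM2l ?powR_ge0.
- by move=> x y _ _ xy; rewrite ltr_pM2l.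
- by rewrite dcE => x _; exact: cst_continuous.
- by rewrite dcE; exact: is_cvg_cst.
- by rewrite dcE; exact: is_cvg_cst.
- split; last exact/cvg_at_right_filter/cc.
  by move=> x _; case: (dc x).
- exact: gt0_cvgMry.
- apply: continuous_subspaceW cf => x /=.
  by rewrite !in_itv/= !andbT; exact: le_trans.
Qed.

(** * Summation over the epochs *)

(** The tangent at y lies below the convex function x^(- s); summed over a
    subdivision, this compares a lower Riemann sum of s x^(- (1 + s)) with its
    integral. *)
Lemma powRN_telescope {R : realType} (s x y : R) : 0 <= s -> 0 < x -> 0 < y ->
  s * (y - x) * y `^ (- (1 + s)) <= x `^ (- s) - y `^ (- s).
Proof.
move=> s_ge0 x_gt0 y_gt0.
have u_gt0 : 0 < x / y by rewrite divr_gt0.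
(* Dividing by y^(- s) reduces the claim to s (1 - u) <= u^(- s) - 1 with
   u = x / y, which follows from e^t >= 1 + t at t = - s ln u and ln u <= u - 1. *)
have -> : x `^ (- s) = y `^ (- s) * (x / y) `^ (- s).
  by rewrite -powRM ?(ltW u_gt0) ?(ltW y_gt0)// mulrC divfK ?gt_eqF.
rewrite opprD powRD ?(gt_eqF y_gt0) ?implybT// (powRN y 1) powRr1 ?(ltW y_gt0)//.
have -> : s * (y - x) * (y^-1 * y `^ (- s)) = y `^ (- s) * (s * (1 - x / y)).
  by field; rewrite gt_eqF.
rewrite -[X in _ <= _ - X]mulr1 -mulrBr ler_wpM2l ?powR_ge0// lerBrDr.
rewrite /powR gt_eqF// addrC (le_trans _ (expR_ge1Dx _))// lerD2l mulNr -mulrN.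
rewrite ler_wpM2l// lerNr opprB.
have := @le_ln1Dx _ (x / y - 1); rewrite subrKC; apply.
by rewrite ltrBrDr addNr.
Qed.

(** The boundary term at N on the left is what makes the induction go through. *)
Lemma epoch_summation_by_parts {R : realType} (r : nat) (g : nat -> R)
    (N : nat) :
  (1 < r)%N -> (forall k, 0 <= g k) ->
  \sum_(k < N) (epoch r k.+1)%:R * (g k - g k.+1) + (epoch r N.+1)%:R * g N <=
  r%:R * (g 0%N + \sum_(k < N) ((epoch r k.+1)%:R - (epoch r k)%:R) * g k.+1).
Proof.
move=> r_gt1 g_ge0; elim: N => [|N IHN].
  by rewrite !big_ord0 add0r addr0 /epoch expn1.
have epochB : (epoch r N.+2)%:R - (epoch r N.+1)%:R <=
    r%:R * ((epoch r N.+1)%:R - (epoch r N)%:R) :> R.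
  have r_ge1 : 1 <= r%:R :> R by rewrite ler1n ltnW.
  rewrite mulrBr /epoch expnS natrM lerD2l lerN2.
  case: N {IHN} => [|N]; first by rewrite mulr0 ler0n.
  by rewrite -natrM -expnS.
rewrite !big_ord_recr/= addrA [leRHS]mulrDr.
have := ler_wpM2r (g_ge0 N.+1) epochB.
lra.
Qed.

(** Here [g k] stands for G(b + n_k mu) / G(b) and m for mu / b. *)
Lemma sum_epoch_increment_le {R : realType} (r : nat) (m s : R) (g : nat -> R)
    (N : nat) :
  (1 < r)%N -> 0 < m -> 0 < s -> (forall k, 0 <= g k) ->
  (forall k, g k <= (1 + (epoch r k)%:R * m) `^ (- (1 + s))) ->
  \sum_(k < N) (epoch r k.+1)%:R * (g k - g k.+1) <= r%:R + r%:R / (s * m).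
Proof.
move=> r_gt1 m_gt0 s_gt0 g_ge0 g_le.
pose u k : R := 1 + (epoch r k)%:R * m.
have u_gt0 k : 0 < u k by rewrite ltr_wpDr// mulr_ge0// ltW.
have epochS k : (epoch r k)%:R <= (epoch r k.+1)%:R :> R.
  rewrite ler_nat; case: k => [|k]; first exact: leq0n.
  by rewrite leq_exp2l.
have g0_le1 : g 0%N <= 1.
  by have := g_le 0%N; rewrite /epoch mul0r addr0 powR1.
have sum_le : s * m *
    (\sum_(k < N) ((epoch r k.+1)%:R - (epoch r k)%:R) * g k.+1) <= 1.
  rewrite mulr_sumr.
  apply: (@le_trans _ _ (\sum_(k < N) (u k `^ (- s) - u k.+1 `^ (- s)))).
    apply: ler_sum => k _.
    apply: (le_trans _
      (powRN_telescope s _ _ (ltW s_gt0) (u_gt0 k) (u_gt0 k.+1))).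
    have -> : u k.+1 - u k = m * ((epoch r k.+1)%:R - (epoch r k)%:R).
      by rewrite /u; ring.
    by rewrite !mulrA ler_wpM2l// !mulr_ge0 ?(ltW s_gt0) ?(ltW m_gt0)// subr_ge0.
  rewrite -(big_mkord xpredT (fun k => u k `^ (- s) - u k.+1 `^ (- s))).
  rewrite (eq_bigr (fun k => - (u k.+1 `^ (- s) - u k `^ (- s)))); last first.
    by move=> k _; rewrite opprB.
  rewrite sumrN telescope_sumr// opprB /u [epoch r 0]/= mul0r addr0 powR1.
  by rewrite gerBl powR_ge0.
have := @epoch_summation_by_parts R r g N r_gt1 g_ge0.
have : 0 <= (epoch r N.+1)%:R * g N by rewrite mulr_ge0.
set S := \sum_(k < N) _; set S' := \sum_(k < N) _ => T_ge0 SS'.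
rewrite -[X in X + _]mulr1 -mulrDr.
apply: (@le_trans _ _ (r%:R * (g 0%N + S'))).
  by rewrite (le_trans _ SS')// lerDl.
by rewrite ler_wpM2l// lerD// -[leRHS]mul1r ler_pdivlMr ?mulr_gt0// mulrC.
Qed.

(** * The tail and the integrated tail *)

Section tail.
Context {R : realType} {d : measure_display} {T : measurableType d}.
Context {P : probability T R} (X : {RV P >-> R}).

Lemma EFin_tail x : (tail X x)%:E = ccdf X x.
Proof. by rewrite fineK// fin_num_measure. Qed.

Lemma tail_ge0 x : 0 <= tail X x.
Proof. exact: fine_ge0. Qed.

Lemma tailI_ge0 x : 0 <= tailI X x.
Proof. by apply: Rintegral_ge0 => u _; exact: tail_ge0. Qed.

Lemma measurable_tail : measurable_fun setT (tail X).
Proof.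
apply/measurable_EFinP; rewrite (_ : _ \o _ = ccdf X).
  exact: ccdf_measurable.
by apply/funext => x; exact: EFin_tail.
Qed.

(** The integral of the tail over [0, +oo[ is the mean of the positive part. *)
Lemma integral_tail_lty a : P.-integrable setT (EFin \o X) -> 0 <= a ->
  (\int[@lebesgue_measure R]_(x in `[a, +oo[) (tail X x)%:E < +oo)%E.
Proof.
move=> intX a_ge0.
have : ('E_P[(X : T -> R)^\+%R] < +oo)%E.
  rewrite unlock.
  have /integrableP[_] := integrable_funrpos measurableT intX.
  by under eq_integral do rewrite /= ger0_norm ?funrpos_ge0//.
rewrite (@ge0_expectation_ccdf _ _ _ _ (X : T -> R)^\+%R); last first.
  by move=> w; exact: funrpos_ge0.
apply: le_lt_trans; apply: (@le_trans _ _
  (\int[@lebesgue_measure R]_(x in `[0%R, +oo[) (tail X x)%:E)%E).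
  apply: ge0_subset_integral => //.
  - by apply/measurable_EFinP/measurable_funTS; exact: measurable_tail.
  - by move=> x _; rewrite lee_fin tail_ge0.
  - by move=> x /=; rewrite !in_itv/= !andbT; exact: le_trans.
rewrite le_eqVlt; apply/orP; left; apply/eqP.
apply: eq_integral => x; rewrite inE/= in_itv/= andbT => x_ge0.
rewrite EFin_tail /ccdf /distribution /pushforward; congr (P _).
apply/seteqP; split => w /=; rewrite !in_itv/= !andbT /funrpos lt_max.
  by move=> ->.
by case/orP => // /(le_lt_trans x_ge0); rewrite ltxx.
Qed.

End tail.

(** A Potter bound for the integrated tail, uniform in c. *)
Lemma tailI_dilation_le {R : realType} {d : measure_display}
    {T : measurableType d} {P : probability T R} (X : {RV P >-> R})
    (alpha delta : R) (L : R -> R) :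
  P.-integrable setT (EFin \o X) ->
  (forall x, 0 < x -> tail X x = x `^ (- alpha) * L x) ->
  assumption2 L ->
  0 < delta ->
  \forall b \near +oo, forall c, 1 <= c ->
    tailI X (c * b) <= c `^ (1 - (alpha - delta)) * tailI X b.
Proof.
move=> intX tailE [t0 t0_gt0 [dL _ oL]] delta_gt0.
have L_ge0 : \forall x \near +oo, 0 <= L x.
  near=> x; have x_gt0 : 0 < x by near: x; exact: nbhs_pinfty_gt (num_real _).
  by have := tail_ge0 X x; rewrite tailE// pmulr_rge0// powR_gt0.
near=> b => c c_ge1.
have tb : t0 <= b by near: b; exact: nbhs_pinfty_ge (num_real _).
have b_gt0 := lt_le_trans t0_gt0 tb.
have tail_decr x y : b <= x -> x <= y ->
    y `^ (alpha - delta) * tail X y <= x `^ (alpha - delta) * tail X x.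
  move=> bx xy; have x_gt0 := lt_le_trans b_gt0 bx.
  have y_gt0 := lt_le_trans x_gt0 xy.
  rewrite !tailE// !mulrA -!powRD ?(gt_eqF x_gt0) ?(gt_eqF y_gt0) ?implybT//.
  have -> : alpha - delta - alpha = - delta by ring.
  move: x y bx xy {x_gt0 y_gt0}; near: b.
  exact: nonincreasing_powRN_mul dL L_ge0 oL.
have tail_cont : {within `[b, +oo[, continuous (tail X)}.
  pose g x := x `^ (- alpha) * L x.
  apply: (@subspace_eq_continuous _ _ _ g).
    move=> x; rewrite inE/= in_itv/= andbT => bx.
    by rewrite /= /from_subspace/= tailE// (lt_le_trans b_gt0).
  apply: derivable_within_continuous => x; rewrite in_itv/= andbT => bx.
  apply: derivableM; last exact/dL/(le_trans tb).
  by case: (is_derive1_powR (- alpha) (lt_le_trans b_gt0 bx)).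
have b_ge0 := ltW b_gt0.
have le_int := ge0_integral_dilation_le (tail X) (alpha - delta) b c b_gt0 c_ge1
  (measurable_tail X) tail_cont (tail_ge0 X) tail_decr.
have fin_int a : 0 <= a ->
    (\int[@lebesgue_measure R]_(x in `[a, +oo[) (tail X x)%:E)%E \is a fin_num.
  move=> a_ge0; rewrite ge0_fin_numE; first exact: integral_tail_lty.
  by apply: integral_ge0 => x _; rewrite lee_fin tail_ge0.
rewrite -lee_fin EFinM /tailI /Rintegral !fineK ?fin_int//.
by rewrite mulr_ge0// (le_trans ler01).
Unshelve. all: end_near. Qed.

(** * The expected number of increments *)

(** The value K = 0 is harmless, because no increment is then generated. *)
Lemma expectation_sim_nu_le {R : realType} {d : measure_display}
    {T : measurableType d} {P : probability T R} (X : nat -> {RV P >-> R})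
    (mu : R) (r : nat) (b : R) (p : nat -> R) (s : simulation X mu r b p)
    (M : R) :
  (forall N : nat, \sum_(k < N) (epoch r k.+1)%:R * p k.+1 <= M) ->
  ('E_(sim_Q s)[fun w => (sim_nu w)%:R] <= M%:E)%E.
Proof.
move=> sumM.
have mK k : measurable [set w | sim_K (s := s) w = k].
  rewrite -[X in measurable X]setTI.
  exact: (sim_K_measurable (s := s) measurableT (Y := [set k])).
rewrite unlock.
under eq_integral do rewrite /sim_nu size_tuple.
rewrite (_ : setT = \bigcup_k [set w | sim_K (s := s) w = k]); last first.
  by apply/seteqP; split => // w _; exists (sim_K w).
rewrite ge0_integral_bigcup//; last 2 first.
- apply: measurable_funTS.
  by apply: (measurableT_comp (f := fun k => (epoch r k)%:R%:E)) => //;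
    exact: sim_K_measurable.
- by move=> k l _ _ [w [/= <- <-]].
have intK k :
    (\int[sim_Q s]_(w in [set w | sim_K w = k]) (epoch r (sim_K w))%:R%:E =
     (epoch r k)%:R%:E * sim_Q s [set w | sim_K w = k])%E.
  rewrite -integral_cst//; apply: eq_integral => w.
  by rewrite inE/= => ->.
under eq_eseriesr do rewrite intK.
apply: lime_le.
  by apply: is_cvg_nneseries => n _ _; rewrite mule_ge0// lee_fin.
apply: nearW => -[|N].
  by rewrite big_geq// lee_fin; have := sumM 0%N; rewrite big_ord0.
rewrite big_nat_recl// mul0e add0e big_mkord.
rewrite (eq_bigr (fun k : 'I_N => ((epoch r k.+1)%:R * p k.+1)%:E)).
  by rewrite sumEFin lee_fin; exact: sumM.
by move=> k _; rewrite sim_K_law.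
Qed.

Lemma expectation_sim_nu_dilation_le {R : realType} {d : measure_display}
    {T : measurableType d} {P : probability T R} (X : nat -> {RV P >-> R})
    (mu b s : R) (r : nat)
    (sim : simulation X mu r b (block_prob (X 0%N) mu b r)) :
  0 < mu -> (1 < r)%N -> 0 < b -> 0 < s ->
  (forall c, 1 <= c ->
    tailI (X 0%N) (c * b) <= c `^ (- (1 + s)) * tailI (X 0%N) b) ->
  ('E_(sim_Q sim)[fun w => (sim_nu w)%:R] <=
   (r%:R + r%:R * b / (mu * s))%:E)%E.
Proof.
move=> mu_gt0 r_gt1 b_gt0 s_gt0 dil.
apply: expectation_sim_nu_le => N.
pose g k := tailI (X 0%N) (b + (epoch r k)%:R * mu) / tailI (X 0%N) b.
rewrite (eq_bigr (fun k : 'I_N => (epoch r k.+1)%:R * (g k - g k.+1)));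
  last first.
  by move=> k _; rewrite /block_prob /g mulrBl.
have -> : r%:R * b / (mu * s) = r%:R / (s * (mu / b)).
  by field; rewrite !gt_eqF.
apply: sum_epoch_increment_le => //; first by rewrite divr_gt0.
  by move=> k; rewrite divr_ge0// tailI_ge0.
move=> k; rewrite /g.
have -> : b + (epoch r k)%:R * mu = (1 + (epoch r k)%:R * (mu / b)) * b.
  by field; rewrite gt_eqF.
set c := 1 + _.
have c_ge1 : 1 <= c by rewrite lerDl mulr_ge0// divr_ge0// ltW.
(* If G(b) = 0, the ratio is 0 by the convention on division by 0. *)
have [G0|G_neq0] := eqVneq (tailI (X 0%N) b) 0.
  by rewrite G0 invr0 mulr0 powR_ge0.
by rewrite ler_pdivrMr ?dil// lt_def G_neq0 tailI_ge0.
Qed.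

Theorem theorem3 (R : realType) (d : measure_display) (T : measurableType d)
    (P : probability T R) (X : nat -> {RV P >-> R})
    (alpha : R) (L : R -> R) (mu : R) (r : nat)
    (iidX : iid X)
    (intX : P.-integrable setT (EFin \o X 0%N)) (meanX : ('E_P[X 0%N] = 0)%E)
    (mu_gt0 : 0 < mu) (r_gt1 : (1 < r)%N)
    (A1 : assumption1 (X 0%N) alpha L) (A2 : assumption2 L)
    (alpha_gt2 : 2 < alpha)
    (sim : forall b : R, 0 < b ->
      simulation X mu r b (block_prob (X 0%N) mu b r)) :
  exists2 eps : R -> R, eps b @[b --> +oo] --> (0 : R) &
    \forall b \near +oo, forall b_gt0 : 0 < b,
      ('E_(sim_Q (sim b b_gt0))[fun w => (sim_nu w)%:R] <=
       ((r%:R + eps b) / (mu * (alpha - 2)) * b)%:E)%E.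
Proof.
have [_ _ tailE _] := A1.
set a := alpha - 2; have a_gt0 : 0 < a by rewrite subr_gt0.
have r_gt0 : 0 < r%:R :> R by rewrite ltr0n ltnW.
pose E b b_gt0 := ('E_(sim_Q (sim b b_gt0))[fun w => (sim_nu w)%:R])%E.
have E_ge0 b b_gt0 : (0 <= E b b_gt0)%E.
  by rewrite /E unlock; apply: integral_ge0 => w _; rewrite lee_fin.
have E_le (eta : R) : 0 < eta -> \forall b \near +oo, forall b_gt0 : 0 < b,
    (E b b_gt0 <= ((r%:R + eta) / (mu * a) * b)%:E)%E.
  move=> eta_gt0.
  (* This delta solves r a / (a - delta) = r + eta / 2; the other half of eta
     absorbs the term r of the bound once b is large. *)
  pose delta := a * eta / (2 * r%:R + eta).
  have den_gt0 : 0 < 2 * r%:R + eta by rewrite addr_gt0// mulr_gt0.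
  have delta_gt0 : 0 < delta by rewrite divr_gt0// mulr_gt0.
  have sE : a - delta = a * (2 * r%:R) / (2 * r%:R + eta).
    by rewrite /delta; field; rewrite gt_eqF.
  have s_gt0 : 0 < a - delta by rewrite sE divr_gt0// !mulr_gt0.
  near=> b => b_gt0.
  apply: (@le_trans _ _ (r%:R + r%:R * b / (mu * (a - delta)))%:E).
    apply: expectation_sim_nu_dilation_le => //.
    have -> : - (1 + (a - delta)) = 1 - (alpha - delta) by rewrite /a; ring.
    by near: b; exact: tailI_dilation_le intX tailE A2 delta_gt0.
  have b_ge : 2 * (mu * a * r%:R) / eta <= b.
    by near: b; exact: nbhs_pinfty_ge (num_real _).
  rewrite lee_fin sE.
  have -> : r%:R + r%:R * b / (mu * (a * (2 * r%:R) / (2 * r%:R + eta)))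
    = (r%:R + eta / 2) / (mu * a) * b + r%:R.
    by field; rewrite !gt_eqF.
  have -> : (r%:R + eta) / (mu * a) * b =
    (r%:R + eta / 2) / (mu * a) * b + eta * b / (2 * (mu * a)).
    by field; rewrite !gt_eqF.
  rewrite lerD2l ler_pdivlMr ?mulr_gt0//.
  by move: b_ge; rewrite ler_pdivrMr//; lra.
(* For b > 0 with a finite expectation, eps b is the smallest nonnegative number
   for which the bound holds at b. *)
pose eps b : R := if pselect (0 < b) is left b_gt0
  then Num.max 0 (fine (E b b_gt0) * (mu * a) / b - r%:R) else 0.
exists eps.
  apply/cvgrPdist_le => eta eta_gt0.
  near=> b; rewrite sub0r normrN /eps; case: pselect => [b_gt0|_]; last first.
    by rewrite normr0 ltW.
  rewrite ger0_norm ?le_max ?lexx// ge_max ltW//= lerBlDl.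
  rewrite ler_pdivrMr// -ler_pdivlMr ?mulr_gt0// mulrAC.
  have Eb : (E b b_gt0 <= ((r%:R + eta) / (mu * a) * b)%:E)%E.
    by move: b_gt0; near: b; exact: E_le.
  by rewrite -lee_fin fineK// ge0_fin_numE// (le_lt_trans Eb) ?ltry.
near=> b => b_gt0; rewrite -/(E b b_gt0) /eps.
case: pselect => // b_gt0'.
rewrite (Prop_irrelevance b_gt0' b_gt0).
have Eb : (E b b_gt0 <= ((r%:R + 1) / (mu * a) * b)%:E)%E.
  by move: b_gt0 {b_gt0'}; near: b; exact: E_le.
rewrite -[leLHS]fineK ?ge0_fin_numE// ?(le_lt_trans Eb) ?ltry// lee_fin.
rewrite mulrAC ler_pdivlMr ?mulr_gt0// -ler_pdivrMr// -lerBlDl.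
by rewrite le_max lexx orbT.
Unshelve. all: end_near. Qed.
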